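(* Let $p\ge 1$, let $P_n$ be a path on $n$ vertices, let $\lambda$ be a $p$-periodic 1-labeling of $P_n$, and let $\mathcal{P}=(P_n,\lambda)$. Then $M_p(\mathcal{P})=1$.
   Context: A $p$-periodic 1-labeling $\lambda$ of a finite simple undirected graph $G=(V,E)$ assigns to each edge $e$ an infinite set of time-steps of the form $\{i,i+p,i+2p,\dots\}$ with $i\in\{1,\dots,p\}$ (so each edge is present exactly once in every $p$ consecutive time-steps). In the temporal graph $\mathcal{G}=(G,\lambda)$, a journey from $u$ to $v$ is a path in $G$ from $u$ to $v$ together with a choice, for each edge of the path, of a time-step in its label set so that the chosen time-steps are strictly increasing along the path. The temporal distance $\mathrm{dist}_t(u,v)$ is the smallest time-step at which a journey from $u$ reaches $v$ (with $\mathrm{dist}_t(u,u)=0$, and $\infty$ if there is no journey). A set $R\subseteq V$ is a temporal resolving set if (i) for every $v\in V$ there is a journey from some $s\in R$ to $v$ (every vertex is reached from itself), and (ii) for every two distinct $u,v\in V$ there is $s\in R$ with $\mathrm{dist}_t(s,u)\neq\mathrm{dist}_t(s,v)$. $M_p(\mathcal{G})$ denotes the minimum size of a temporal resolving set of $\mathcal{G}$. *)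

(* Defs.v *)
From HB Require Import structures.
From mathcomp Require Import all_boot.
From mathcomp Require Import boolp.

Set Implicit Arguments.
Unset Strict Implicit.
Unset Printing Implicit Defensive.

Record sgraph := SGraph {
  vertex :> finType;
  adj : rel vertex;
  adj_sym : symmetric adj;
  adj_irrefl : irreflexive adj }.

Definition edges (G : sgraph) : {set {set G}} :=
  [set [set e.1; e.2] | e : G * G & adj e.1 e.2].

Definition is_path_graph (n : nat) (G : sgraph) : Prop :=
  exists2 f : 'I_n -> G, bijective f &
    forall i j : 'I_n, adj (f i) (f j) = (i.+1 == j) || (j.+1 == i).

(* Only the values on [edges G] matter. *)
Definition labeling (G : sgraph) := {set G} -> pred nat.

Definition periodic_1_labeling (p : nat) (G : sgraph) (lam : labeling G) : Prop :=
  forall E : {set G}, E \in edges G ->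
    exists2 i : nat, 1 <= i <= p &
      forall t : nat, t \in lam E <-> exists k : nat, t = i + k * p.

Section TemporalGraph.
Variables (G : sgraph) (lam : labeling G).

(* A journey starting at u is encoded by the list of its pairs (vertex entered,
   time-step of the edge used to enter it).  The start is paired with time 0;
   as time-steps are positive, this does not constrain the first edge, and it
   makes 0 the arrival time of the empty journey from u to u. *)
Definition tstep (x y : G * nat) : bool :=
  [&& adj x.1 y.1, y.2 \in lam [set x.1; y.1] & x.2 < y.2].

Definition journey (u v : G) (s : seq (G * nat)) : bool :=
  [&& path tstep (u, 0) s, uniq (u :: unzip1 s) & (last (u, 0) s).1 == v].

Definition arrival (u : G) (s : seq (G * nat)) : nat := (last (u, 0) s).2.

Definition reached_at (u v : G) (t : nat) : Prop :=
  exists2 s, journey u v s & arrival u s = t.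

(* [None] stands for infinity. *)
Definition dist_t (u v : G) : option nat :=
  if pselect (exists t, `[< reached_at u v t >]) is left h
  then Some (ex_minn h) else None.

Definition temporal_resolving (R : {set G}) : Prop :=
  (forall v : G, exists2 s, s \in R & exists j, journey s v j) /\
  (forall u v : G, u != v ->
     exists2 s, s \in R & dist_t s u <> dist_t s v).

Lemma dist_tP (u v : G) (t : nat) :
  dist_t u v = Some t <->
  reached_at u v t /\ forall t', reached_at u v t' -> t <= t'.
Proof.
rewrite /dist_t; case: pselect => [h|nh]; last first.
  by split=> // -[ut _]; case: nh; exists t; apply/asboolP.
case: ex_minnP => m /asboolP um min_m; split=> [[<-]|[ut min_t]].
  by split=> // t' /asboolP; apply: min_m.
by congr Some; apply/eqP; rewrite eqn_leq min_t // min_m //; apply/asboolP.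
Qed.

Lemma reached_at_refl (u : G) : reached_at u u 0.
Proof. by exists [::]; rewrite // /journey /= eqxx. Qed.

Lemma dist_t_refl (u : G) : dist_t u u = Some 0.
Proof. by apply/dist_tP; split=> //; apply: reached_at_refl. Qed.

Lemma dist_t_eq0 (u v : G) : dist_t u v = Some 0 -> u = v.
Proof.
case/dist_tP=> -[s /and3P[ps _ /eqP <-] s0] _.
case/lastP: s ps s0 => [//|s x]; rewrite rcons_path /arrival last_rcons.
by case/andP=> _ /and3P[_ _ lt_x] x0; rewrite x0 in lt_x.
Qed.

Lemma temporal_resolving_setT : temporal_resolving [set: G].
Proof.
split=> [v|u v uv]; [exists v; rewrite ?inE // | exists u; rewrite ?inE //].
  by have [s js _] := reached_at_refl v; exists s.
rewrite dist_t_refl => /esym/dist_t_eq0 /eqP.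
by rewrite (negPf uv).
Qed.

(* The minimum is over a nonempty family, by [temporal_resolving_setT]. *)
Definition temporal_metric_dimension : nat :=
  #|[arg min_(R < [set: G] | `[< temporal_resolving R >]) #|R| ]|.

End TemporalGraph.

(* Main.v *)
Require Import Defs.
From mathcomp Require Import all_boot.
From mathcomp Require Import boolp.

(** The singleton formed by an endpoint [r] of the path resolves. A journey
starting at [r] cannot turn back, so it visits the positions 0, 1, 2, ... in
order; hence a journey to [v] passes strictly earlier through every vertex
between [r] and [v], and temporal distances from [r] strictly increase along
the path. Every vertex is reached because each edge recurs forever. *)

(** Positions are plain naturals, so that they can be compared with [iota]. That positions are
    actually occupied is assumed separately, where journeys are built. *)
Definition path_position (G : sgraph) (pos : G -> nat) : Prop :=
  injective pos /\
  forall x y, adj x y = ((pos x).+1 == pos y) || ((pos y).+1 == pos x).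

Lemma journey_rcons (G : sgraph) (lam : labeling G) (u v : G)
    (s : seq (G * nat)) (x : G * nat) :
  journey lam u v (rcons s x) =
  [&& journey lam u (last (u, 0) s).1 s, tstep lam (last (u, 0) s) x,
      x.1 \notin u :: unzip1 s & x.1 == v].
Proof.
rewrite /journey rcons_path /unzip1 map_rcons -rcons_cons rcons_uniq last_rcons.
rewrite eqxx andbT -!andbA; do !bool_congr.
Qed.

(** Induction on the last step: it moves to a neighbouring position, and the lower neighbour has
    already been visited, so [uniq] forces the move upwards. *)
Lemma journey_positions {G : sgraph} {lam : labeling G} {pos : G -> nat}
    {r v : G} {s : seq (G * nat)} :
  path_position G pos -> pos r = 0 -> journey lam r v s ->
  map pos (r :: unzip1 s) = iota 0 (pos v).+1.
Proof.
move=> [pos_inj adjE] r0; elim/last_ind: s v => [|s x IH] v.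
  by case/and3P=> _ _ /eqP <- /=; rewrite r0.
rewrite journey_rcons => /and4P[/IH]; set w := (last _ _).1 => sE.
case/and3P=> wx _ _ xs /eqP <-.
have xw : pos x.1 = (pos w).+1.
  move: wx; rewrite adjE => /orP[/eqP <- //|/eqP wE].
  case/negP: xs; rewrite -(mem_map pos_inj) sE mem_iota /= -wE.
  by rewrite add0n ltnS leqnSn.
rewrite /unzip1 map_rcons -rcons_cons map_rcons sE xw.
by rewrite -[in RHS]addn1 iotaD cats1.
Qed.

(** Dropping the last step of a journey gives a strictly earlier journey to the preceding position;
    this is repeated until [u] is reached. *)
Lemma reached_before {G : sgraph} {lam : labeling G} {pos : G -> nat}
    {r u v : G} {t : nat} :
  path_position G pos -> pos r = 0 -> reached_at lam r v t -> pos u < pos v ->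
  exists2 t', t' < t & reached_at lam r u t'.
Proof.
move=> posP r0 [s]; elim/last_ind: s v t => [|s x IH] v t.
  by case/and3P=> _ _ /eqP <- _; rewrite r0.
move=> jsx; have := journey_positions posP r0 jsx.
move: jsx; rewrite journey_rcons => /and4P[js /and3P[_ _ lt_x] _ /eqP <-].
(* Comparing lengths of the position lists with and without the last step shows that [x.1] lies one
   position after the end of [s]. *)
have /(congr1 size) := journey_positions posP r0 js.
rewrite !(size_map, size_iota, size_rcons) /= size_map => -[sw].
move/(congr1 size); rewrite /= !(size_map, size_iota, size_rcons) sw => -[<-].
rewrite /arrival last_rcons => <-; rewrite ltnS leq_eqVlt => /predU1P[uw|ltuw].
  exists (last (r, 0) s).2 => //; exists s => //.
  by case: posP => /(_ _ _ uw) ->.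
have [t' lt_t' ut'] := IH _ _ js erefl ltuw.
by exists t' => //; apply: ltn_trans lt_t' lt_x.
Qed.

Lemma periodic_label_later {G : sgraph} {lam : labeling G} {p : nat} {x y : G}
    (t : nat) :
  1 <= p -> periodic_1_labeling p lam -> adj x y ->
  exists2 t', t' \in lam [set x; y] & t < t'.
Proof.
move=> p_gt0 lamP xy.
have [|i /andP[i_gt0 _] iP] := lamP [set x; y].
  by apply/imsetP; exists (x, y); rewrite ?inE.
(* Since [i] and [p] are positive, [t] periods after [i] is later than [t]. *)
exists (i + t * p); first by apply/iP; exists t.
by rewrite -add1n leq_add // leq_pmulr.
Qed.

(** Walk upwards, waiting at each vertex for the next occurrence of the edge ahead. *)
Lemma journey_from_endpoint {G : sgraph} {lam : labeling G} {pos : G -> nat}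
    {p : nat} {r : G} (v : G) :
  1 <= p -> periodic_1_labeling p lam -> path_position G pos -> pos r = 0 ->
  (forall k, k < pos v -> exists w, pos w = k) ->
  exists s, journey lam r v s.
Proof.
move=> p_gt0 lamP posP r0; have [pos_inj adjE] := posP.
move vk: (pos v) => k; elim: k v vk => [|k IH] v vk onto.
  by exists [::]; rewrite /journey /= -(inj_eq pos_inj) r0 vk.
have [w wk] := onto k (ltnSn k).
have [s js] : exists s, journey lam r w s.
  by apply: IH => // i ik; apply/onto/ltnW.
have wv : adj w v by rewrite adjE wk vk eqxx.
have [t vt lt_t] := periodic_label_later (last (r, 0) s).2 p_gt0 lamP wv.
have sw : (last (r, 0) s).1 = w by case/and3P: js => _ _ /eqP.
exists (rcons s (v, t)); rewrite journey_rcons /tstep sw js wv vt lt_t eqxx andbT.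
rewrite -(mem_map pos_inj) (journey_positions posP r0 js) mem_iota vk wk.
by rewrite add0n ltnn.
Qed.

Lemma dist_t_reached {G : sgraph} {lam : labeling G} {u v : G}
    {s : seq (G * nat)} :
  journey lam u v s -> exists t, dist_t lam u v = Some t.
Proof.
move=> js; rewrite /dist_t; case: pselect => [h|[]]; first by exists (ex_minn h).
by exists (arrival u s); apply/asboolP; exists s.
Qed.

Lemma endpoint_resolving {G : sgraph} {lam : labeling G} {pos : G -> nat}
    {r : G} :
  path_position G pos -> pos r = 0 ->
  (forall v, exists s, journey lam r v s) ->
  temporal_resolving lam [set r].
Proof.
move=> posP r0 reach; split=> [v|u v uv]; exists r; rewrite ?inE //.
wlog ltuv : u v uv / pos u < pos v => [IH|eq_d].
  case: (ltngtP (pos u) (pos v)) => [|ltvu|/posP.1 E]; first exact: IH.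
    by apply/nesym/IH; rewrite // eq_sym.
  by rewrite E eqxx in uv.
(* Reachability excludes that both distances are [None]. *)
have [s /dist_t_reached[t vt]] := reach v.
have /dist_tP[_ t_min] : dist_t lam r u = Some t by rewrite eq_d.
have /dist_tP[vt_reached _] := vt.
have [t' lt_t' /t_min] := reached_before posP r0 vt_reached ltuv.
by rewrite leqNgt lt_t'.
Qed.

Lemma temporal_metric_dimension_eq1 {G : sgraph} {lam : labeling G} {r : G} :
  temporal_resolving lam [set r] -> temporal_metric_dimension lam = 1.
Proof.
move=> rP; rewrite /temporal_metric_dimension.
case: arg_minnP => [|R /asboolP[cover _] minR].
  by apply/asboolP/temporal_resolving_setT.
apply/eqP; rewrite eqn_leq card_gt0; apply/andP; split.
  by rewrite -(cards1 r) minR //; apply/asboolP.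
(* A resolving set is nonempty because [r] itself must be reached from it. *)
by have [s sR _] := cover r; apply/set0Pn; exists s.
Qed.

Theorem theorem10 (p n : nat) (P : sgraph) (lam : labeling P)
    (hp : 1 <= p) (hn : 1 <= n) (hP : is_path_graph n P)
    (hlam : periodic_1_labeling p lam) :
  temporal_metric_dimension lam = 1.
Proof.
case: hP => f [g fK gK] adj_f.
have posP : path_position P (fun x => g x : nat).
  split=> [x y /val_inj /(can_inj gK) //|x y].
  by rewrite -{1}(gK x) -{1}(gK y) adj_f.
have r0 : g (f (Ordinal hn)) = 0 :> nat by rewrite fK.
apply/temporal_metric_dimension_eq1/(endpoint_resolving posP r0) => v.
apply: (journey_from_endpoint v hp hlam posP r0) => k ltk.
by exists (f (Ordinal (ltn_trans ltk (ltn_ord (g v))))); rewrite fK.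
Qed.
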